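(* Let $X$ be a set and let $\mathbf{d}:X\times X\to[0,\infty]$ be a distance such that $\mathord{\leq^{\mathcal{F}\mathbf{d}}}\circ\overline{\mathbf{d}}\leq\mathcal{F}\mathbf{d}$ (pointwise) and such that every $\leq^{\mathbf{d}}$-directed subset of $X$ has a $\mathbf{d}$-maximum. Then for every $\mathbf{d}$-pre-Cauchy net $(x_\lambda)$ in $X$ there exists a $\underline{\mathbf{d}}^\vee$-Cauchy sequence $(y_n)_{n\in\mathbb{N}}$ in $X$ such that $\mathbf{d}(x_\lambda)=\mathbf{d}(y_n)$, i.e. $\liminf_\lambda z\mathbf{d}x_\lambda=\liminf_n z\mathbf{d}y_n$ for all $z\in X$.
   Context: Write $x\mathbf{d}y=\mathbf{d}(x,y)$. Conventions: $a_+=\max(a,0)$, $\infty-\infty=0$, $\inf\emptyset=\infty$, $\sup\emptyset=0$ in $[0,\infty]$. A relation is identified with the function equal to $0$ where it holds and $\infty$ elsewhere. For $\mathbf{f}:A\times C\to[0,\infty]$, $\mathbf{g}:C\times B\to[0,\infty]$, $a(\mathbf{f}\circ\mathbf{g})b=\inf_{c\in C}(a\mathbf{f}c+c\mathbf{g}b)$. $\mathbf{d}$ is a distance if $x\mathbf{d}y\leq x\mathbf{d}z+z\mathbf{d}y$ for all $x,y,z$. $x\leq^{\mathbf{d}}y$ means $x\mathbf{d}y=0$. $x\overline{\mathbf{d}}z=\sup_{y\in X}(x\mathbf{d}y-z\mathbf{d}y)_+$, $z\underline{\mathbf{d}}y=\sup_{x\in X}(x\mathbf{d}y-x\mathbf{d}z)_+$,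 and $x\underline{\mathbf{d}}^\vee y=\max(x\underline{\mathbf{d}}y,y\underline{\mathbf{d}}x)$. With $\mathcal{F}(X)$ the set of finite subsets of $X$, $\mathcal{F}\mathbf{d}:\mathcal{F}(X)\times X\to[0,\infty]$ is $F(\mathcal{F}\mathbf{d})y=\sup_{x\in F}x\mathbf{d}y$, and $F\leq^{\mathcal{F}\mathbf{d}}y$ means $F(\mathcal{F}\mathbf{d})y=0$. Nets $(x_\lambda)_{\lambda\in\Lambda}$ are indexed by non-empty sets $\Lambda$ with a transitive, possibly non-reflexive relation $\prec$ such that for all $\gamma,\delta$ there is $\lambda$ with $\gamma,\delta\prec\lambda$; limits (inferior, superior) use tails $\{\lambda:\lambda\succ\gamma\}$. For $\mathbf{f}:X\times X\to[0,\infty]$, $(x_\lambda)$ is $\mathbf{f}$-pre-Cauchy iff $\lim_\gamma\limsup_\delta x_\gamma\mathbf{f}x_\delta=0$, and $\mathbf{f}$-Cauchy iff $\lim_\gamma\sup_{\delta\succ\gamma}x_\gamma\mathbf{f}x_\delta=0$. $Y\subseteq X$ is $\leq^{\mathbf{d}}$-directed if every finite $F\subseteq Y$ (including $\emptyset$) has some $y\in Y$ with $x\leq^{\mathbf{d}}y$ for all $x\in F$. $x$ is a $\mathbf{d}$-maximum of $Y$ if $y\mathbf{d}x=0$ for all $y\in Y$ and $\inf_{y\in Y}z\mathbf{d}y\leq z\mathbf{d}x$ for all $z\in X$. *)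

(* Defs.v *)
(* The value set [0, oo] is the non-negative part of \bar R
   for R : realType. *)
From mathcomp Require Import all_boot all_order all_algebra.
From mathcomp Require Import all_classical all_reals all_analysis.
Set Implicit Arguments.
Unset Strict Implicit.
Unset Printing Implicit Defensive.
Import Order.TTheory GRing.Theory Num.Theory.
Local Open Scope classical_set_scope.
Local Open Scope ring_scope.
Local Open Scope ereal_scope.

Section Distances.
Context {R : realType}.

(* Supremum in [0, oo]: unlike ereal_sup, the empty set is sent to 0. *)
Definition sup0 (A : set (\bar R)) : \bar R := maxe 0 (ereal_sup A).

(* (a - b)_+ on [0, oo]; in \bar R, +oo - +oo = -oo, hence
   pos_diff +oo +oo = 0 as required by the convention oo - oo = 0. *)
Definition pos_diff (a b : \bar R) : \bar R := maxe 0 (a - b).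

Definition rel_fun (A B : Type) (r : A -> B -> Prop) (a : A) (b : B) : \bar R :=
  if `[< r a b >] then 0 else +oo.

Definition comp_fun (A C B : Type) (f : A -> C -> \bar R) (g : C -> B -> \bar R)
    (a : A) (b : B) : \bar R :=
  ereal_inf [set f a c + g c b | c in [set: C]].

Section OneDistance.
Context {X : Type}.
Implicit Types (d : X -> X -> \bar R) (x y z : X) (F Y : set X).

Definition distance d : Prop :=
  (forall x y, 0 <= d x y) /\ (forall x y z, d x y <= d x z + d z y).

Definition le_dist d x y : Prop := d x y = 0.

Definition upper_dist d x z : \bar R :=
  sup0 [set pos_diff (d x y) (d z y) | y in [set: X]].

Definition lower_dist d z y : \bar R :=
  sup0 [set pos_diff (d x y) (d x z) | x in [set: X]].

Definition lower_dist_sym d x y : \bar R :=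
  maxe (lower_dist d x y) (lower_dist d y x).

(* Only used on finite F. *)
Definition fin_dist d F y : \bar R := sup0 [set d x y | x in F].

Definition le_fin_dist d F y : Prop := fin_dist d F y = 0.

Definition directed_set d Y : Prop :=
  forall F, finite_set F -> F `<=` Y ->
    exists2 y, Y y & forall x, F x -> le_dist d x y.

Definition dist_maximum d Y x : Prop :=
  (forall y, Y y -> d y x = 0) /\
  (forall z, ereal_inf [set d z y | y in Y] <= d z x).

End OneDistance.

Section Nets.
Context {L : Type}.
Implicit Types (prec : L -> L -> Prop).

(* Reflexivity is not assumed. *)
Definition net_index prec : Prop :=
  [/\ inhabited L,
      forall a b c, prec a b -> prec b c -> prec a c &
      forall a b, exists2 c, prec a c & prec b c].

Definition net_tail prec (g : L) : set L := [set l | prec g l].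

Definition net_filter prec : set_system L :=
  [set A | exists g, net_tail prec g `<=` A].

(* limf_esup and limf_einf need a choiceType as domain, which L is not. *)
Definition net_limsup prec (u : L -> \bar R) : \bar R :=
  ereal_inf [set sup0 [set u l | l in net_tail prec g] | g in [set: L]].

Definition net_liminf prec (u : L -> \bar R) : \bar R :=
  sup0 [set ereal_inf [set u l | l in net_tail prec g] | g in [set: L]].

Definition pre_cauchy (X : Type) (f : X -> X -> \bar R) prec (x : L -> X) : Prop :=
  net_limsup prec (fun l => f (x g) (x l)) @[g --> net_filter prec]
    --> (0 : \bar R).

Definition cauchy_net (X : Type) (f : X -> X -> \bar R) prec (x : L -> X) : Prop :=
  sup0 [set f (x g) (x l) | l in net_tail prec g] @[g --> net_filter prec]
    --> (0 : \bar R).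

End Nets.

(* Sequences are nets indexed by nat with its strict order. *)
Definition nat_prec (m n : nat) : Prop := (m < n)%N.

End Distances.

(* Main.v *)
(* Write phi z = liminf_l d(z, x_l), which is an actual limit because x is
   pre-Cauchy. For e > 0 let Y be the set of points y with
   limsup_l d(y, x_l) < e. Given a finite F in Y, pick l far enough and apply the
   composition hypothesis to F and x_l: it yields a point above F whose distances
   exceed those of x_l by less than e, hence a point of Y. So Y is directed, and a
   d-maximum y of Y satisfies d(z, y) <= phi z because Y contains a tail of the net,
   and phi z <= d(z, y) + e by the triangle inequality through points of Y. Taking
   e = 1 / (n + 1) gives y_n with d(-, y_n) converging uniformly to phi. *)
Require Import Defs.
From mathcomp Require Import all_boot all_order all_algebra.
From mathcomp Require Import all_classical all_reals all_analysis.
From mathcomp Require Import lra.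
Import Order.TTheory GRing.Theory Num.Theory.
Local Open Scope classical_set_scope.
Local Open Scope ring_scope.
Local Open Scope ereal_scope.

Section SupAndDifference.
Context {R : realType}.
Implicit Types (A : set (\bar R)) (a b : \bar R).

(* all_reals exports a lemma also named sup0, hence the qualified Defs.sup0 below. *)
Lemma sup0_ge0 A : 0 <= Defs.sup0 A.
Proof. by rewrite /Defs.sup0 le_max lexx. Qed.

Lemma sup0_ubound {A a} : A a -> a <= Defs.sup0 A.
Proof. by move=> Aa; rewrite /Defs.sup0 le_max ereal_sup_ubound ?orbT. Qed.

Lemma ge_sup0 A b : 0 <= b -> (forall a, A a -> a <= b) -> Defs.sup0 A <= b.
Proof. by move=> b0 Ab; rewrite /Defs.sup0 ge_max b0; exact: ge_ereal_sup. Qed.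

(** For [b = +oo] both sides hold, because [pos_diff a +oo = 0]; for finite [b] the subtraction can
    be undone. *)
Lemma pos_diff_le a b (e : R) : 0 <= a -> 0 <= b -> (0 <= e)%R ->
  (pos_diff a b <= e%:E) = (a <= b + e%:E).
Proof.
move=> a0 b0 e0; rewrite /pos_diff ge_max lee_fin e0 /=.
case: b b0 => [r r0| _|//]; first by rewrite leeBlDr// addeC.
by rewrite /= addeNy leNye leey.
Qed.

End SupAndDifference.

Section NetLimits.
Context {R : realType} {L : Type} {prec : L -> L -> Prop}.
Hypothesis prec_net : net_index prec.
Implicit Types (u : L -> \bar R) (a : \bar R) (g : L).

Lemma net_tail_meet g h :
  exists2 k, prec g k /\ prec h k &
    forall l, prec k l -> prec g l /\ prec h l.
Proof.
case: prec_net => _ tr /(_ g h)[k gk hk]; exists k => // l kl.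
by split; [exact: tr gk kl|exact: tr hk kl].
Qed.

Lemma net_limsup_lt u a : net_limsup prec u < a ->
  exists g, forall l, prec g l -> u l < a.
Proof.
move=> /ereal_inf_lt[_ [g _ <-] ga]; exists g => l gl.
by apply: le_lt_trans ga; apply: sup0_ubound; exists l.
Qed.

Lemma le_net_liminf u a g : (forall l, prec g l -> a <= u l) ->
  a <= net_liminf prec u.
Proof.
move=> au; apply: le_trans (sup0_ubound _); last by exists g.
by apply: le_ereal_inf_tmp => _ [l /= gl <-]; exact: au.
Qed.

Lemma net_liminf_le {u a} g : 0 <= a -> (forall l, prec g l -> u l <= a) ->
  net_liminf prec u <= a.
Proof.
move=> a0 ua; apply: ge_sup0 => // _ [h _ <-].
have [k [gk hk] _] := net_tail_meet g h.
by apply: ge_ereal_inf; exists (u k); [exists k|exact: ua].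
Qed.

(** Encodes limsup [u] < [e]; the explicit [r] leaves a positive margin [e - r] to spend. *)
Definition eventually_below u (e : R) : Prop :=
  exists2 r : R, (0 <= r < e)%R & exists g, forall l, prec g l -> u l <= r%:E.

Lemma eventually_below_finite {X : Type} (F : set X) (u : X -> L -> \bar R) e :
  (0 < e)%R -> finite_set F -> (forall x, F x -> eventually_below (u x) e) ->
  exists2 r : R, (0 <= r < e)%R &
    exists g, forall l, prec g l -> forall x, F x -> u x l <= r%:E.
Proof.
move=> e0; case/(@finite_seqP {classic X}) => s ->{F}.
elim: s => [_|x s IH us].
  (* For empty [F] the bound 0 lies below [e], and any index serves. *)
  exists 0%R; first by rewrite lexx.
  by case: prec_net => -[g] _ _; exists g.
have [|r /andP[r0 re] [g gu]] := IH.
  by move=> z zs; apply: us; rewrite /= inE zs orbT.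
have [|r' /andP[r'0 r'e] [g' gu']] := us x; first by rewrite /= inE eqxx.
exists (Num.max r r'); first by rewrite le_max r0 gt_max re r'e.
have [h _ hgg'] := net_tail_meet g g'.
exists h => l /hgg'[gl g'l] z; rewrite /= inE => /predU1P[->|zs].
  by apply: le_trans (gu' _ g'l) _; rewrite lee_fin le_max lexx orbT.
by apply: le_trans (gu _ gl _ zs) _; rewrite lee_fin le_max lexx.
Qed.

Lemma pre_cauchy_eventually {X : Type} {f : X -> X -> \bar R} {x : L -> X} (e : R) :
  pre_cauchy f prec x -> (0 < e)%R ->
  exists g, forall k, prec g k ->
    exists h, forall l, prec h l -> f (x k) (x l) < e%:E.
Proof.
move=> xf e0; have /xf : nbhs (0 : \bar R) [set a : \bar R | a < e%:E].
  by apply: open_nbhs_nbhs; split; [exact: open_ereal_lt_ereal|rewrite /= lte_fin].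
by move=> [g gP]; exists g => k /gP /= /net_limsup_lt.
Qed.

End NetLimits.

Section UniformApproximation.
Context {R : realType} {X : Type} (d : X -> X -> \bar R).
Hypothesis d_dist : distance d.

Lemma upper_dist_lt c y (e : R) : upper_dist d c y < e%:E ->
  forall z, d c z <= d y z + e%:E.
Proof.
have [d0 _] := d_dist => ce z.
have e0 : (0 <= e)%R by rewrite -lee_fin (le_trans _ (ltW ce))// sup0_ge0.
rewrite -pos_diff_le//; apply: le_trans (ltW ce).
by apply: sup0_ubound; exists z.
Qed.

(** [lower_dist_sym] is the uniform distance between the functions d(-, y) and d(-, y'). *)
Lemma lower_dist_sym_le y y' (e : R) : (0 <= e)%R ->
  (forall z, d z y <= d z y' + e%:E) -> (forall z, d z y' <= d z y + e%:E) ->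
  lower_dist_sym d y y' <= e%:E.
Proof.
have [d0 _] := d_dist => e0 yy' y'y; rewrite /lower_dist_sym ge_max.
by apply/andP; split; apply: ge_sup0; rewrite ?lee_fin// => _ [z _ <-];
  rewrite pos_diff_le.
Qed.

Hypothesis d_comp : forall (F : set X) (x : X), finite_set F ->
  comp_fun (rel_fun (le_fin_dist d)) (upper_dist d) F x <= fin_dist d F x.

Lemma exists_bound_near (F : set X) y (e : R) :
  finite_set F -> fin_dist d F y < e%:E ->
  exists2 c, forall x, F x -> le_dist d x c & forall z, d c z <= d y z + e%:E.
Proof.
have [d0 _] := d_dist => Ffin Fy.
have /ereal_inf_lt[_ [c _ <-]] := le_lt_trans (d_comp F y Ffin) Fy.
(* A point [c] not above [F] contributes [+oo], which cannot be below [e]. *)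
rewrite /rel_fun; case: asboolP => [Fc|_]; last first.
  by rewrite addye// gt_eqF// (lt_le_trans _ (sup0_ge0 _)).
rewrite add0e => cy; exists c; last exact: upper_dist_lt.
move=> x Fx; apply/eqP; rewrite eq_le d0 andbT -Fc.
by apply: sup0_ubound; exists x.
Qed.

Hypothesis d_max :
  forall Y : set X, directed_set d Y -> exists x, dist_maximum d Y x.
Context {L : Type} {prec : L -> L -> Prop} (x : L -> X).
Hypothesis prec_net : net_index prec.
Hypothesis x_pc : pre_cauchy d prec x.

Lemma directed_eventually_below (e : R) : (0 < e)%R ->
  directed_set d [set y | eventually_below (prec := prec) (fun l => d y (x l)) e].
Proof.
have [d0 dD] := d_dist => e0 F Ffin FY.
have [r /andP[r0 re] [g gF]] := eventually_below_finite prec_net F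
  (fun y l => d y (x l)) e e0 Ffin FY.
(* One [t] makes the bound on [fin_dist] strict, a second pays for passing from [x k] to [x l]; the
   total [r + t + t] stays below [e]. *)
pose t := ((e - r) / 3)%R.
have t0 : (0 < t)%R by rewrite /t; lra.
have [h hx] := pre_cauchy_eventually _ x_pc t0.
have [k [gk hk] _] := net_tail_meet prec_net g h.
have [|c Fc cx] := exists_bound_near F (x k) (r + t)%R Ffin.
  apply: (@le_lt_trans _ _ r%:E); last by rewrite lte_fin ltrDl.
  by apply: ge_sup0; rewrite ?lee_fin// => _ [y Fy <-]; exact: gF.
exists c => //; exists (r + t + t)%R; first by rewrite /t; apply/andP; split; lra.
have [m mx] := hx _ hk; exists m => l /mx /ltW xkl.
by apply: le_trans (cx _) _; rewrite addeC [leRHS]EFinD leeD2l.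
Qed.

Lemma exists_uniform_approx (e : R) : (0 < e)%R ->
  exists y, forall z, d z y <= net_liminf prec (fun l => d z (x l)) <= d z y + e%:E.
Proof.
have [d0 dD] := d_dist => e0.
have [y [yub ylb]] := d_max _ (directed_eventually_below _ e0).
exists y => z; apply/andP; split.
  (* The bound [e / 2] is strictly below [e], so [x k] belongs to the directed set and
     [d (x k) y = 0]. *)
  have e20 : (0 < e / 2)%R by lra.
  have [g gx] := pre_cauchy_eventually _ x_pc e20.
  apply: (@le_net_liminf _ _ _ _ _ g) => k /gx[h hx].
  rewrite -[leRHS]adde0 -(yub (x k)) ?dD//.
  exists (e / 2)%R; first by apply/andP; split; lra.
  by exists h => l /hx /ltW.
(* As [d z y] dominates the infimum of [d z y'] over the set, each [y'] may be treated alone;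
   passing through it costs at most [r < e] on a tail. *)
rewrite -leeBlDr//; apply: le_trans (ylb z).
apply: le_ereal_inf_tmp => _ [y' [r /andP[r0 re] [g gy']] <-].
rewrite leeBlDr//; apply: (net_liminf_le prec_net g).
  by rewrite adde_ge0// lee_fin ltW.
move=> l /gy' y'r; apply: le_trans (dD _ _ y') _; apply: leeD2l.
by apply: le_trans y'r _; rewrite lee_fin ltW.
Qed.

End UniformApproximation.

Lemma nat_prec_net : net_index nat_prec.
Proof.
split; [by exists; exact: 0%N|by move=> a b c; exact: ltn_trans|move=> a b].
by exists (maxn a b).+1; rewrite /nat_prec ltnS ?leq_maxl ?leq_maxr.
Qed.

Theorem theorem11p4 (R : realType) (X : Type) (d : X -> X -> \bar R)
    (d_dist : distance d)
    (d_comp : forall (F : set X) (x : X), finite_set F ->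
       comp_fun (rel_fun (le_fin_dist d)) (upper_dist d) F x <= fin_dist d F x)
    (d_max : forall Y : set X, directed_set d Y -> exists x, dist_maximum d Y x)
    (L : Type) (prec : L -> L -> Prop) (prec_net : net_index prec)
    (x : L -> X) (x_pc : pre_cauchy d prec x) :
  exists y : nat -> X,
    cauchy_net (lower_dist_sym d) nat_prec y /\
    forall z : X, net_liminf prec (fun l => d z (x l)) =
                  net_liminf nat_prec (fun n => d z (y n)).
Proof.
have [d0 dD] := d_dist.
have [y yP] := choice (fun n => exists_uniform_approx d d_dist d_comp d_max x
  prec_net x_pc (@harmonic R n) (harmonic_gt0 n)).
(* The errors decrease, so the one at [m] serves for the whole sequence from [m] on. *)
have yle m n : (m <= n)%N -> forall z,
    net_liminf prec (fun l => d z (x l)) <= d z (y n) + (harmonic m)%:E.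
  move=> mn z; have /andP[_ /le_trans] := yP n z; apply.
  by rewrite leeD2l// lee_fin /harmonic lef_pV2 ?posrE// ler_nat ltnS.
exists y; split.
  move=> A A0.
  have : Defs.sup0 [set lower_dist_sym d (y n) (y m) | m in net_tail nat_prec n]
      @[n --> \oo] --> (0 : \bar R).
    apply: squeeze_cvge (cvg_cst _) cvge_harmonic.
    apply: nearW => n; rewrite sup0_ge0 /=.
    apply: ge_sup0; first by rewrite lee_fin harmonic_ge0.
    (* Both d(-, y_n) and d(-, y_m) lie below the limit function, so going through it costs a single
       error 1 / (n + 1) in either direction. *)
    move=> _ [m /ltnW nm <-]; apply: lower_dist_sym_le => // [z|z].
    - have /andP[/le_trans yn _] := yP n z; apply: yn; exact: yle.
    - have /andP[/le_trans ym _] := yP m z; apply: ym; exact: yle.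
  (* The strict tail after [N] is contained in the set of [n] with [N <= n]. *)
  by move=> /(_ A A0)[N _ NA]; exists N => n /ltnW; exact: NA.
move=> z; apply/eqP; rewrite eq_le; apply/andP; split; last first.
  apply: (net_liminf_le nat_prec_net 0%N); first exact: sup0_ge0.
  by move=> n _; have /andP[] := yP n z.
apply/lee_addgt0Pr => e e0.
have [N _ /(_ N (leqnn N)) Ne] := near_infty_natSinv_lt (PosNum e0).
rewrite -leeBlDr//; apply: (@le_net_liminf _ _ _ _ _ N) => n /ltnW Nn.
rewrite leeBlDr//; apply: le_trans (yle _ _ Nn z) _.
by rewrite leeD2l// lee_fin ltW.
Qed.
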